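(* Let $R>r>0$ and $d>0$ with $d^2=R^2-6Rr+r^2$, let $\Gamma,\gamma$ be circles of radii $R,r$ whose centres are at distance $d$, and put $a=\frac1r$, $A=-\frac1R$. For a Steiner $4$-chain with parent circles $\gamma,\Gamma$ and radii $r_1,\dots,r_4$, let $L=\sum_{j=1}^4 r_j$. Over all Steiner $4$-chains with parent circles $\gamma,\Gamma$, the maximum of $L$ is attained at the axial chain and equals $$-\frac{A^2-2Aa+a^2}{Aa(a+A)},$$ and the minimum of $L$ is attained at the two lateral chains and equals $$\frac{16(A+a)}{A^2-2Aa+a^2}.$$
   Context: A Steiner $4$-chain with parent circles $\gamma,\Gamma$ (where $\gamma$ lies inside the interior disk of $\Gamma$) is a sequence of circles $\delta_1,\dots,\delta_4$ such that $\delta_i$ and $\delta_{i+1}$ are externally tangent for all $i$ (indices mod $4$), and each $\delta_i$ is externally tangent to $\gamma$ and internally tangent to $\Gamma$. Let $\ell$ be the line through the centres of $\gamma$ and $\Gamma$. The axial chain is the Steiner $4$-chain two of whose circles have centres on $\ell$ (it contains the circle of maximal radius $\frac{R-r+d}{2}$ and the circle of minimal radius $\frac{R-r-d}{2}$). The lateral chains are the two Steiner $4$-chains symmetric with respect to $\ell$ none of whose circles has its centre on $\ell$.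
   Formalization: The four circles of a Steiner 4-chain are required to be distinct (otherwise δ1,δ2,δ1,δ2 can exceed the stated maximum), and the ''two lateral chains'' are the two opposite cyclic orders of one and the same set of four circles. *)

(* Defs.v *)
From HB Require Import structures.
From mathcomp Require Import all_boot all_order all_algebra.

Set Implicit Arguments.
Unset Strict Implicit.
Unset Printing Implicit Defensive.

Import Order.TTheory GRing.Theory Num.Theory.
Local Open Scope ring_scope.

Section Plane.
Variable K : rcfType.

Definition point := 'rV[K]_2.

Definition dot (u v : point) : K := \sum_i u 0 i * v 0 i.

Definition dist (p q : point) : K := Num.sqrt (dot (p - q) (p - q)).

Definition on_line (p q x : point) : Prop := exists t : K, x = p + t *: (q - p).

(* Orthogonal reflection in the line through p and q, meaningful for p != q:
   twice the foot of the perpendicular from x, minus x. *)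
Definition reflect_point (p q x : point) : point :=
  let v := q - p in
  2%:R *: (p + (dot (x - p) v / dot v v) *: v) - x.

Record circle := Circle {
  center : point;
  radius : K;
  radius_gt0 : 0 < radius
}.

Definition on_circle (c : circle) (x : point) : Prop :=
  dist x (center c) = radius c.

Definition in_open_disk (c : circle) (x : point) : Prop :=
  dist x (center c) < radius c.

Definition lies_inside (c c' : circle) : Prop :=
  forall x, on_circle c x -> in_open_disk c' x.

Definition externally_tangent (c c' : circle) : Prop :=
  dist (center c) (center c') = radius c + radius c'.

(* c is the inner circle. *)
Definition internally_tangent (c c' : circle) : Prop :=
  radius c < radius c' /\ dist (center c) (center c') = radius c' - radius c.

Definition reflect_circle (p q : point) (c : circle) : circle :=
  Circle (reflect_point p q (center c)) (radius_gt0 c).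

(* Arithmetic in 'Z_4 makes the indices cyclic. The circles are required to be
   distinct: otherwise d1, d2, d1, d2 with d1 tangent to d2 would be a chain. *)
Definition steiner4_chain (gam Gam : circle) (delta : 'Z_4 -> circle) : Prop :=
  [/\ lies_inside gam Gam,
      injective delta,
      forall i, externally_tangent (delta i) (delta (i + 1)),
      forall i, externally_tangent (delta i) gam
    & forall i, internally_tangent (delta i) Gam].

Definition axial_chain (gam Gam : circle) (delta : 'Z_4 -> circle) : Prop :=
  steiner4_chain gam Gam delta /\
  exists i j, [/\ i != j,
    on_line (center gam) (center Gam) (center (delta i))
  & on_line (center gam) (center Gam) (center (delta j))].

Definition lateral_chain (gam Gam : circle) (delta : 'Z_4 -> circle) : Prop :=
  [/\ steiner4_chain gam Gam delta,
      forall i, exists j,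
        delta j = reflect_circle (center gam) (center Gam) (delta i)
    & forall i, ~ on_line (center gam) (center Gam) (center (delta i))].

Definition same_circles (delta eps : 'Z_4 -> circle) : Prop :=
  forall c, (exists i, delta i = c) <-> (exists i, eps i = c).

(* The same cyclic sequence, up to the choice of the initial circle. *)
Definition same_cyclic_sequence (delta eps : 'Z_4 -> circle) : Prop :=
  exists k, forall i, eps i = delta (i + k).

Definition radii_sum (delta : 'Z_4 -> circle) : K := \sum_i radius (delta i).

End Plane.

(* Main.v *)
(** Identify the plane with the complex numbers, the line of centres with the
    real axis.  An inversion making the two parents concentric turns the circles
    tangent to both into congruent ones, so such a circle is determined by a
    complex number [u] of modulus 1, its direction; its curvature is
    [((R - r) + d * Re u) / (2 * R * r)].  The relation
    [d^2 = R^2 - 6 R r + r^2] says that two of them are externally tangent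
    exactly when [v^2 = - u^2], so the directions of a Steiner 4-chain are
    [u, w u, w^2 u, w^3 u] with [w] one of the two square roots of [-1], and the
    circles of the chain are determined by [u^4].  The axial chain is the case
    [u^4 = 1], the lateral chains are the case [u^4 = -1].  Adding the radii in
    opposite pairs gives
    [32 R r (R - r) (R + r)^2 / (2 (R + r)^4 - d^4 (1 + Re (u^4)))],
    which increases with [Re (u^4)]. *)
Require Import Defs.
From HB Require Import structures.
From mathcomp Require Import all_boot all_order all_algebra.
From mathcomp Require Import complex ring lra.

Set Implicit Arguments.
Unset Strict Implicit.
Unset Printing Implicit Defensive.

Import Order.TTheory GRing.Theory Num.Theory.
Local Open Scope complex_scope.
Local Open Scope ring_scope.

Local Notation Re := complex.Re.
Local Notation Im := complex.Im.

(** * Complex numbers of modulus 1 *)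

Section NormOne.

Lemma norm1_neq0 (F : numDomainType) (u : F) : `|u| = 1 -> u != 0.
Proof. by move=> u1; rewrite -normr_eq0 u1 oner_eq0. Qed.

Lemma norm1_of_exp (F : numDomainType) n (u : F) :
  (0 < n)%N -> `|u ^+ n| = 1 -> `|u| = 1.
Proof. by move=> n_gt0 /eqP; rewrite normrX pexpr_eq1 // => /eqP. Qed.

Variable C : numClosedFieldType.
Implicit Types u : C.

Lemma norm1_invC u : `|u| = 1 -> u^-1 = u^*.
Proof. by move=> u1; rewrite invC_norm u1 expr1n invr1 mul1r. Qed.

Lemma norm1_sqr_eq1 u : `|u| = 1 -> (u ^+ 2 == 1) = (u \is Num.real).
Proof.
move=> u1; rewrite -[1 in LHS](expr1n _ 2) -{1}u1 normCK expr2 CrealE.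
by rewrite (inj_eq (mulfI (norm1_neq0 u1))) eq_sym.
Qed.

End NormOne.

Section RootPowers.

Lemma expr_ZpD (M : pzSemiRingType) n (w : M) (i j : 'Z_n) :
  (1 < n)%N -> w ^+ n = 1 -> w ^+ (i + j)%R = w ^+ i * w ^+ j.
Proof.
by case: n i j => [|[|n]] // i j _ wn; rewrite -exprD -[RHS](expr_mod _ wn).
Qed.

Lemma sqrN1_prim_root (F : numDomainType) (w : F) :
  w ^+ 2 = -1 -> 4.-primitive_root w.
Proof.
move=> w2; have w4 : w ^+ 4 = 1 by rewrite (exprM w 2 2) w2 sqrrN expr1n.
have [m w_prim] := prim_order_exists (isT : 0 < 4)%N w4.
have : ~~ (m %| 2)%N by rewrite (prim_order_dvd w_prim) w2 eqNr oner_eq0.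
by case: m w_prim => [|[|[|[|[|m]]]]].
Qed.

End RootPowers.

Section ComplexOverReal.
Variable K : rcfType.
Implicit Types u v w : K[i].

Lemma Re_mulJ u v : Re (u * v^*) = Re u * Re v + Im u * Im v.
Proof. by case: u v => a b [c e] /=; rewrite mulrN opprK. Qed.

Lemma normc_eq1 u : (`|u| == 1) = (Re u ^+ 2 + Im u ^+ 2 == 1).
Proof.
by rewrite -(pexpr_eq1 (n := 2)) // -add_Re2_Im2 -(rmorph1 (real_complex K))
           (inj_eq (@complexI K)).
Qed.

Lemma Re_norm1_bounds u : `|u| = 1 -> -1 <= Re u <= 1.
Proof. by move=> u1; rewrite -ler_norml -lecR rmorph1 -u1 normc_ge_Re. Qed.

Lemma Re_sqr_norm1 u : `|u| = 1 -> Re (u ^+ 2) = 2%:R * Re u ^+ 2 - 1.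
Proof. by case: u => a b /eqP; rewrite normc_eq1 => /eqP /= u1; lra. Qed.

Lemma norm1_orthogonal u v : `|u| = 1 -> `|v| = 1 ->
  (Re (u * v^*) == 0) = (v ^+ 2 == - u ^+ 2).
Proof.
move=> u1 v1; have [un vn] := (norm1_neq0 u1, norm1_neq0 v1).
have cos_sum : (Re (u * v^*))%:C * (2%:R * u * v) = v ^+ 2 + u ^+ 2.
  rewrite complexRe ReE rmorphM /= conjCK -!norm1_invC //.
  by field; rewrite un vn.
rewrite -[RHS]subr_eq0 opprK -cos_sum !mulf_eq0 (negPf un) (negPf vn).
by rewrite pnatr_eq0 !orbF (inj_eq (@complexI K)).
Qed.

(* The right-hand side has the shape of the summands, with [u ^+ 2] for [u], so
   the lemma iterates to the vertices of a regular [2 ^ n]-gon. *)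
Lemma antipodal_sum (a b : K) u : `|u| = 1 -> `|b| < a ->
  (a + b * Re u)^-1 + (a - b * Re u)^-1
  = 4%:R * a / (2%:R * a ^+ 2 - b ^+ 2 - b ^+ 2 * Re (u ^+ 2)).
Proof.
move=> u1 ba; have : `|b * Re u| < a.
  apply: le_lt_trans ba.
  by rewrite normrM ler_piMr // ler_norml Re_norm1_bounds.
rewrite ltr_norml => /andP[gt_Na lt_a]; rewrite Re_sqr_norm1 //.
have den_gt0 : 0 < a + b * Re u by lra.
have denN_gt0 : 0 < a - b * Re u by lra.
have prod_gt0 := mulr_gt0 den_gt0 denN_gt0.
by field; rewrite !gt_eqF //=; lra.
Qed.

Lemma quarter_turns_sum (a b : K) w u :
  w ^+ 2 = -1 -> `|u| = 1 -> `|b| < a ->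
  \sum_(i < 4) (a + b * Re (w ^+ i * u))^-1
  = 16%:R * a * (2%:R * a ^+ 2 - b ^+ 2)
    / (2%:R * (2%:R * a ^+ 2 - b ^+ 2) ^+ 2 - b ^+ 4 * (1 + Re (u ^+ 4))).
Proof.
move=> w2 u1 ba.
have w1 : `|w| = 1 by apply: (norm1_of_exp (n := 2)); rewrite ?w2 ?normrN1.
have wu1 : `|w * u| = 1 by rewrite normrM w1 u1 mulr1.
have u2 : `|u ^+ 2| = 1 by rewrite normrX u1 expr1n.
have b2 : `|b ^+ 2| < 2%:R * a ^+ 2 - b ^+ 2.
  have b2a2 : b ^+ 2 < a ^+ 2 by move: ba; rewrite ltr_norml => /andP[]; nra.
  by rewrite ger0_norm ?sqr_ge0 //; lra.
have w3 : w ^+ 3 = - w by rewrite exprS w2 mulrN1.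
have u4 : u ^+ 2 ^+ 2 = u ^+ 4 by rewrite -exprM.
have ReN v : Re (- v) = - Re v by case: v.
transitivity ((a + b * Re u)^-1 + (a - b * Re u)^-1
              + ((a + b * Re (w * u))^-1 + (a - b * Re (w * u))^-1)).
  rewrite !big_ord_recl big_ord0 /= /bump /= expr0 expr1 mul1r w2 w3 mulN1r.
  by rewrite mulNr !ReN !mulrN addr0 [_ + (_ + _)]addrA addrACA.
rewrite !antipodal_sum // exprMn w2 mulN1r ReN mulrN opprK -mulrDr addrC.
by rewrite (antipodal_sum u2 b2) u4 mulrA; congr (_ / _); ring.
Qed.

End ComplexOverReal.

(** * A complex coordinate adapted to two points *)

Section Affix.
Variable K : rcfType.
Implicit Types x y : point K.

Definition affix x : K[i] := x 0 0 +i* x 0 1.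

Lemma affixD x y : affix (x + y) = affix x + affix y.
Proof. by rewrite /affix !mxE. Qed.

Lemma affixB x y : affix (x - y) = affix x - affix y.
Proof. by rewrite /affix !mxE. Qed.

Lemma affixZ (t : K) x : affix (t *: x) = t%:C * affix x.
Proof.
by apply/eqP; rewrite eq_complex /= !mxE !mul0r subr0 addr0 !eqxx.
Qed.

Definition point_of_affix (z : K[i]) : point K :=
  \row_i (if i == 0 then Re z else Im z).

Lemma point_of_affixK : cancel point_of_affix affix.
Proof. by case=> a b; rewrite /affix !mxE. Qed.

Lemma affixK : cancel affix point_of_affix.
Proof.
move=> x; apply/rowP => -[[|[|//]] i_lt2]; rewrite mxE /=;
  by congr (x _ _); apply: val_inj.
Qed.

Lemma affix_inj : injective affix.
Proof. exact: can_inj affixK. Qed.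

Lemma dotE x y : dot x y = Re (affix x * (affix y)^*).
Proof.
rewrite /dot big_ord_recl big_ord1 Re_mulJ /=.
by congr (_ + x _ _ * y _ _); apply: val_inj.
Qed.

Lemma dist_affix x y : (dist x y)%:C = `|affix x - affix y|.
Proof. by rewrite normc_def -affixB /dist dotE Re_mulJ -!expr2. Qed.

Lemma dist_eq0 x y : (dist x y == 0) = (x == y).
Proof.
by rewrite -(inj_eq (@complexI K)) dist_affix normr_eq0 subr_eq0
           (inj_eq affix_inj).
Qed.

Lemma dist_eqP x y (t : K) :
  0 <= t -> dist x y = t <-> dist x y ^+ 2 = t ^+ 2.
Proof.
move=> t_ge0; split=> [->//|/eqP].
by rewrite eqrXn2 ?sqrtr_ge0 // => /eqP.
Qed.

Lemma dist_triangle y x z : dist x z <= dist x y + dist y z.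
Proof. by rewrite -lecR rmorphD /= !dist_affix ler_distD. Qed.

End Affix.

Section Frame.
Variables (K : rcfType) (p q : point K).
Implicit Types x y : point K.
Hypothesis pq : p != q.
Local Notation d := (dist p q).
Local Notation axis := (affix q - affix p).

Definition coord x : K[i] := (affix x - affix p) * d%:C / axis.

Definition point_at (z : K[i]) : point K :=
  point_of_affix (affix p + z * axis / d%:C).

Let d_neq0 : d%:C != 0 :> K[i].
Proof. by rewrite (inj_eq (@complexI K)) dist_eq0. Qed.

Let axis_neq0 : axis != 0.
Proof. by rewrite subr_eq0 (inj_eq (@affix_inj K)) eq_sym. Qed.

Lemma point_atK : cancel point_at coord.
Proof.
move=> z; rewrite /coord /point_at point_of_affixK.
by field; rewrite axis_neq0 d_neq0.
Qed.

Lemma dist_sqr_coord x y :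
  dist x y ^+ 2 = (Re (coord x) - Re (coord y)) ^+ 2
                  + (Im (coord x) - Im (coord y)) ^+ 2.
Proof.
have rotation_norm1 : `|d%:C / axis| = 1.
  rewrite normrM normfV (distrC (affix q)) -dist_affix ger0_norm ?divff //.
  by rewrite ler0c sqrtr_ge0.
have normB : (dist x y)%:C = `|coord x - coord y|.
  have -> : coord x - coord y = (affix x - affix y) * (d%:C / axis).
    by rewrite /coord; ring.
  by rewrite normrM rotation_norm1 mulr1 dist_affix.
by apply: (@complexI K); rewrite rmorphXn /= normB -add_Re2_Im2 !raddfB.
Qed.

Lemma coord_origin : coord p = 0.
Proof. by rewrite /coord subrr !mul0r. Qed.

Lemma coord_axis : coord q = d%:C.
Proof. by rewrite /coord mulrAC divff // mul1r. Qed.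

Lemma on_line_coord x : on_line p q x <-> Im (coord x) = 0.
Proof.
split=> [[t ->]|im0].
  rewrite /coord affixD affixZ affixB addrAC subrr add0r mulrAC mulfK //.
  by rewrite -rmorphM.
have [t coordE] : exists t, coord x = t%:C.
  by exists (Re (coord x)); apply/eqP; rewrite eq_complex im0 !eqxx.
exists (t / d); apply: affix_inj.
rewrite affixD affixZ affixB rmorphM fmorphV /= -coordE /coord.
by field; rewrite d_neq0 axis_neq0.
Qed.

Lemma coord_reflect x : coord (reflect_point p q x) = (coord x)^*.
Proof.
have dotC u v :
    (dot u v)%:C = (affix u * (affix v)^* + (affix u)^* * affix v) / 2%:R.
  by rewrite dotE complexRe ReE rmorphM /= conjCK.
have dot_self v : (dot v v)%:C = affix v * (affix v)^* by rewrite dotC; field.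
have axisJ_neq0 : axis^* != 0 by rewrite conjC_eq0.
have reflect_affix : affix (reflect_point p q x) - affix p
    = (affix x - affix p)^* * axis / axis^*.
  rewrite /reflect_point affixB affixZ affixD affixZ rmorph_nat.
  rewrite (fmorph_div (real_complex K)) /= dot_self dotC !affixB.
  move: axis axis_neq0 axisJ_neq0 => v v_neq0 vJ_neq0.
  by rewrite rmorphB; field; rewrite vJ_neq0 v_neq0.
have dJ : (d%:C)^* = d%:C :> K[i] by rewrite dist_affix conj_normC.
rewrite /coord reflect_affix rmorphM fmorphV rmorphM /= dJ.
move: axis axis_neq0 axisJ_neq0 => v v_neq0 vJ_neq0.
by field; rewrite vJ_neq0 v_neq0.
Qed.

End Frame.

(** * Circles tangent to both parents *)

Section CirclePairs.
Variable K : rcfType.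
Implicit Types e f : circle K.

Lemma circle_eq e f : center e = center f -> radius e = radius f -> e = f.
Proof.
case: e f => [p a a_gt0] [q b b_gt0] /= centerE radiusE.
case: _ / centerE; case: _ / radiusE in b_gt0 *.
by congr Circle; apply: bool_irrelevance.
Qed.

Lemma lies_inside_of_dist e f :
  dist (center e) (center f) + radius e < radius f -> lies_inside e f.
Proof.
move=> near x; rewrite /on_circle /in_open_disk => xe.
apply: le_lt_trans near; apply: le_trans (dist_triangle (center e) _ _) _.
by rewrite xe addrC.
Qed.

End CirclePairs.

Section Annulus.
Variables (K : rcfType) (gam Gam : circle K).
Local Notation r := (radius gam).
Local Notation R := (radius Gam).
Local Notation d := (dist (center gam) (center Gam)).
Local Notation coord := (coord (center gam) (center Gam)).
Local Notation reflect := (reflect_circle (center gam) (center Gam)).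
Implicit Types (e f : circle K) (u w : K[i]) (delta eps : 'Z_4 -> circle K).
Hypothesis rR : r < R.
Hypothesis d_gt0 : 0 < d.
Hypothesis d_sqr : d ^+ 2 = R ^+ 2 - 6%:R * R * r + r ^+ 2.

Definition abscissa e : K := Re (coord (center e)).
Definition ordinate e : K := Im (coord (center e)).
Arguments abscissa : simpl never.
Arguments ordinate : simpl never.

Definition inscribed e : Prop :=
  externally_tangent e gam /\ internally_tangent e Gam.

(* The direction, seen from the common centre, of the image of [e] under an
   inversion with centre on the axis that makes [gam] and [Gam] concentric.
   Four images form a closed ring, so their centres lie at [Num.sqrt 2] times
   their radius from the common centre; the inversion preserves the ratio of
   the ordinate to the radius. *)
Definition direction e : K[i] :=
  ((2%:R * R * r / radius e - (R - r)) / d)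
    +i* (ordinate e / (radius e * Num.sqrt 2%:R)).

Let r_gt0 : 0 < r. Proof. exact: radius_gt0. Qed.
Let R_gt0 : 0 < R. Proof. exact: radius_gt0. Qed.
Let radius_neq0 e : radius e != 0. Proof. by rewrite gt_eqF ?radius_gt0. Qed.
Let d_neq0 : d != 0. Proof. by rewrite gt_eqF. Qed.
Let centers_neq : center gam != center Gam. Proof. by rewrite -dist_eq0. Qed.
Let sqrt2_neq0 : Num.sqrt 2%:R != 0 :> K.
Proof. by rewrite gt_eqF // sqrtr_gt0. Qed.
Let sqrt2_sqr : (Num.sqrt 2%:R : K) ^+ 2 = 2%:R.
Proof. by rewrite sqr_sqrtr. Qed.

Lemma center_distance_lt : d < R - 3%:R * r.
Proof.
have d2_gt0 := exprn_gt0 2 d_gt0; rewrite d_sqr in d2_gt0.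
have [r0 r_lt_R] := (r_gt0, rR).
have diff_gt0 : 0 < R - 3%:R * r by nra.
by rewrite -ltr_sqr ?nnegrE ?ltW // d_sqr; nra.
Qed.

Lemma curvatureE e : radius e * (R - r + d * Re (direction e)) = 2%:R * R * r.
Proof. by rewrite /direction /=; field; rewrite d_neq0 radius_neq0. Qed.

Lemma radiusE e : radius e = 2%:R * R * r / (R - r + d * Re (direction e)).
Proof.
have Rr_neq0 : 2%:R * R * r != 0 by rewrite !mulf_neq0 ?pnatr_eq0.
rewrite -(curvatureE e) mulfK //.
by move: Rr_neq0; rewrite -(curvatureE e) mulf_eq0 negb_or => /andP[].
Qed.

Lemma ordinateE e : ordinate e = Num.sqrt 2%:R * radius e * Im (direction e).
Proof. by rewrite /direction /=; field; rewrite sqrt2_neq0 radius_neq0. Qed.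

Lemma inscribedP e : inscribed e <->
  [/\ d * abscissa e = r * (r - 3%:R * R) + (r + R) * radius e,
      abscissa e ^+ 2 + ordinate e ^+ 2 = (r + radius e) ^+ 2
    & radius e < R].
Proof.
have to_gam : dist (center e) (center gam) ^+ 2
              = abscissa e ^+ 2 + ordinate e ^+ 2.
  by rewrite (dist_sqr_coord centers_neq) coord_origin !subr0.
have to_Gam : dist (center e) (center Gam) ^+ 2
              = (abscissa e - d) ^+ 2 + ordinate e ^+ 2.
  by rewrite (dist_sqr_coord centers_neq) coord_axis // subr0.
rewrite /inscribed /externally_tangent /internally_tangent.
split=> [[ext [e_lt int]]|[absc modulus e_lt]].
  rewrite ext in to_gam; rewrite int in to_Gam; rewrite -to_gam.
  by split=> //; have := d_sqr; lra.
have e_gt0 := radius_gt0 e; split; last split=> //; apply/dist_eqP.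
- by rewrite addr_ge0 ?ltW.
- by rewrite to_gam modulus addrC.
- by rewrite subr_ge0 ltW.
- by rewrite to_Gam; have := d_sqr; lra.
Qed.

(* The tangency equation, polarized: at a single circle it makes the direction
   of modulus 1, at two circles it gives their distance. *)
Lemma abscissa_mul (a b x y c c' : K) :
    d * x = r * (r - 3%:R * R) + (r + R) * a ->
    d * y = r * (r - 3%:R * R) + (r + R) * b ->
    a * (R - r + d * c) = 2%:R * R * r -> b * (R - r + d * c') = 2%:R * R * r ->
  x * y = r ^+ 2 + r * (a + b) - a * b + 2%:R * a * b * c * c'.
Proof.
move=> xE yE acurv bcurv; apply: (mulfI (expf_neq0 2 d_neq0)).
have ac : d * (a * c) = 2%:R * R * r - (R - r) * a by rewrite -acurv; ring.
have bc : d * (b * c') = 2%:R * R * r - (R - r) * b by rewrite -bcurv; ring.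
transitivity ((d * x) * (d * y)); first by ring.
transitivity (d ^+ 2 * (r ^+ 2 + r * (a + b) - a * b)
              + 2%:R * (d * (a * c)) * (d * (b * c'))); last by ring.
by rewrite xE yE ac bc d_sqr; ring.
Qed.

Lemma dist_inscribed e f : inscribed e -> inscribed f ->
  dist (center e) (center f) ^+ 2
  = (radius e + radius f) ^+ 2
    - 4%:R * radius e * radius f * Re (direction e * (direction f)^*).
Proof.
move=> /inscribedP[ex emod _] /inscribedP[fx fmod _].
rewrite (dist_sqr_coord centers_neq) Re_mulJ.
rewrite -/(abscissa e) -/(abscissa f) -/(ordinate e) -/(ordinate f).
have absc_mul := abscissa_mul ex fx (curvatureE e) (curvatureE f).
have ord_mul : ordinate e * ordinate f
    = 2%:R * radius e * radius f * (Im (direction e) * Im (direction f)).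
  by rewrite !ordinateE -[in RHS]sqrt2_sqr; ring.
lra.
Qed.

Lemma direction_norm1 e : inscribed e -> `|direction e| = 1.
Proof.
move=> ie; have dist0 : dist (center e) (center e) = 0.
  by apply/eqP; rewrite dist_eq0.
have := dist_inscribed ie ie; rewrite dist0 => dist_ee.
have radii_neq0 : 4%:R * radius e * radius e != 0.
  by rewrite !mulf_neq0 ?pnatr_eq0.
apply/eqP; rewrite normc_eq1 !expr2 -Re_mulJ; apply/eqP.
by apply: (mulfI radii_neq0); lra.
Qed.

Lemma direction_inj e f :
  inscribed e -> inscribed f -> direction e = direction f -> e = f.
Proof.
move=> ie fi dirE.
have same_radius : radius e = radius f by rewrite (radiusE e) dirE -radiusE.
apply: circle_eq => //; apply/eqP; rewrite -dist_eq0 -sqrf_eq0.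
rewrite dist_inscribed // same_radius dirE -normCK direction_norm1 //.
by rewrite expr1n /=; apply/eqP; ring.
Qed.

Lemma tangent_inscribed e f : inscribed e -> inscribed f ->
  externally_tangent e f <-> direction f ^+ 2 = - direction e ^+ 2.
Proof.
move=> ie fi; have [e_gt0 f_gt0] := (radius_gt0 e, radius_gt0 f).
rewrite /externally_tangent dist_eqP ?addr_ge0 ?ltW // dist_inscribed //.
have radii_neq0 : 4%:R * radius e * radius f != 0.
  by rewrite !mulf_neq0 ?pnatr_eq0.
apply: (iff_trans (B := Re (direction e * (direction f)^*) == 0)).
  split=> [dist_sqr|/eqP ->]; last by rewrite mulr0 subr0.
  by apply/eqP/(mulfI radii_neq0); rewrite mulr0; lra.
by rewrite norm1_orthogonal ?direction_norm1 //; split=> /eqP.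
Qed.

Lemma scaled_curvature_gt u : `|u| = 1 -> 2%:R * r < R - r + d * Re u.
Proof.
move=> /Re_norm1_bounds/andP[Re_ge _].
by have [near d0 r0] := And3 center_distance_lt d_gt0 r_gt0; nra.
Qed.

Lemma inscribed_exists u : `|u| = 1 -> exists2 e, inscribed e & direction e = u.
Proof.
move=> u1; have den_gt := scaled_curvature_gt u1.
have den_gt0 : 0 < R - r + d * Re u by have := r_gt0; lra.
have [rho rho_gt0 rhoE] :
    exists2 rho, 0 < rho & rho * (R - r + d * Re u) = 2%:R * R * r.
  exists (2%:R * R * r / (R - r + d * Re u)); last by rewrite divfK // gt_eqF.
  by rewrite divr_gt0 // !mulr_gt0.
have [x xE] : exists x, d * x = r * (r - 3%:R * R) + (r + R) * rho.
  by exists ((r * (r - 3%:R * R) + (r + R) * rho) / d); rewrite mulrC divfK.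
pose z := x +i* (Num.sqrt 2%:R * rho * Im u).
pose e := Circle (point_at (center gam) (center Gam) z) rho_gt0.
have coordE : coord (center e) = z by exact: point_atK.
have [abscE ordE] : abscissa e = x /\ ordinate e = Num.sqrt 2%:R * rho * Im u.
  by rewrite /abscissa /ordinate coordE.
exists e.
  apply/inscribedP; rewrite abscE ordE; split=> //=; last first.
    have twice_r_gt0 : 0 < 2%:R * r by rewrite mulr_gt0.
    rewrite -(ltr_pM2r twice_r_gt0) [ltRHS]mulrCA [ltRHS]mulrA -rhoE.
    by rewrite ltr_pM2l.
  have := abscissa_mul xE xE rhoE rhoE.
  have /eqP := u1; rewrite normc_eq1 => /eqP u_sqr x_sqr.
  have Im_sqr : Im u ^+ 2 = 1 - Re u ^+ 2 by lra.
  by rewrite !exprMn sqrt2_sqr Im_sqr; lra.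
apply/eqP; rewrite eq_complex /direction ordE /=; apply/andP; split; apply/eqP.
  by rewrite -rhoE mulrAC divff ?gt_eqF //; field.
by field; rewrite sqrt2_neq0 gt_eqF.
Qed.

Lemma on_axis_direction e : inscribed e ->
  on_line (center gam) (center Gam) (center e) <-> direction e ^+ 2 = 1.
Proof.
move=> /direction_norm1 dir1; rewrite on_line_coord // -/(ordinate e).
have scale_neq0 : Num.sqrt 2%:R * radius e != 0 by rewrite mulf_neq0.
have -> : (direction e ^+ 2 = 1) <-> (Im (direction e) == 0).
  rewrite (rwP eqP) norm1_sqr_eq1 //.
  by case: (direction e) => a b; rewrite complex_real.
by rewrite ordinateE (rwP eqP) mulf_eq0 (negPf scale_neq0) orFb.
Qed.

Lemma abscissa_reflect e : abscissa (reflect e) = abscissa e.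
Proof. by rewrite /abscissa coord_reflect //; case: (coord _). Qed.

Lemma ordinate_reflect e : ordinate (reflect e) = - ordinate e.
Proof. by rewrite /ordinate coord_reflect //; case: (coord _). Qed.

Lemma direction_reflect e : direction (reflect e) = (direction e)^*.
Proof. by rewrite /direction ordinate_reflect /= mulNr. Qed.

Lemma inscribed_reflect e : inscribed e -> inscribed (reflect e).
Proof.
move=> /inscribedP ie; apply/inscribedP.
by rewrite abscissa_reflect ordinate_reflect sqrrN.
Qed.

(** * Steiner 4-chains *)

(* The square roots [w] of [-1] are the quarter turns in the two senses. *)
Definition turning w delta : Prop :=
  [/\ w ^+ 2 = -1, forall i, inscribed (delta i)
    & forall i, direction (delta i) = w ^+ i * direction (delta 0)].

Definition phase delta : K[i] := direction (delta 0) ^+ 4.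

Lemma turningD w delta i j : turning w delta ->
  direction (delta (i + j)) = w ^+ i * direction (delta j).
Proof.
move=> [w2 _ dirE]; have w4 := prim_expr_order (sqrN1_prim_root w2).
by rewrite dirE expr_ZpD // -mulrA -dirE.
Qed.

Lemma turning_steiner4 w delta :
  turning w delta -> steiner4_chain gam Gam delta.
Proof.
move=> T; have [w2 ins dirE] := T; have w_prim := sqrN1_prim_root w2.
have u_neq0 := norm1_neq0 (direction_norm1 (ins 0)).
split=> [|i j /(congr1 direction)|i|i|i]; try by case: (ins i).
- apply: lies_inside_of_dist.
  by have := center_distance_lt; have := r_gt0; lra.
- rewrite dirE [RHS]dirE => /(mulIf u_neq0)/eqP.
  by rewrite (eq_prim_root_expr w_prim) !modn_small // => /eqP/val_inj.
- apply/tangent_inscribed => //.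
  by rewrite addrC (turningD _ _ T) exprMn w2 mulN1r.
Qed.

Lemma steiner4_turning delta :
  steiner4_chain gam Gam delta -> exists w, turning w delta.
Proof.
move=> [_ delta_inj tangent tan_gam tan_Gam].
have ins i : inscribed (delta i) by [].
have sqr_step i : direction (delta (i + 1)) ^+ 2 = - direction (delta i) ^+ 2.
  by apply/tangent_inscribed.
have u_neq0 := norm1_neq0 (direction_norm1 (ins 0)).
pose w := direction (delta 1) / direction (delta 0).
have w2 : w ^+ 2 = -1.
  by rewrite expr_div_n -[1]add0r sqr_step mulNr divff ?expf_neq0.
exists w; split=> // i; rewrite -[i in LHS]natr_Zp.
suff [//] : direction (delta i%:R) = w ^+ i * direction (delta 0) /\
            direction (delta i.+1%:R) = w ^+ i.+1 * direction (delta 0).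
elim: (val i) => [|n [IHn IHn1]]; first by rewrite expr0 mul1r expr1 divfK.
split=> //; have : direction (delta n.+2%:R) ^+ 2
                   = (w ^+ n.+2 * direction (delta 0)) ^+ 2.
  by rewrite -natr1 sqr_step IHn1 -mulN1r -w2 -exprMn mulrA -exprS.
move/eqP; rewrite eqf_sqr => /orP[/eqP //|/eqP opposite].
have : direction (delta n.+2%:R) = direction (delta n%:R).
  by rewrite opposite 2!exprS mulrA -expr2 w2 mulN1r mulNr opprK IHn.
move=> /(direction_inj (ins _) (ins _))/delta_inj/eqP.
by rewrite -(addn2 n) natrD -subr_eq0 addrAC subrr add0r.
Qed.

Lemma turning_exists w u : w ^+ 2 = -1 -> `|u| = 1 ->
  exists2 delta, turning w delta & phase delta = u ^+ 4.
Proof.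
move=> w2 u1.
have w1 : `|w| = 1 by apply: (norm1_of_exp (n := 2)); rewrite ?w2 ?normrN1.
have vertex (i : 'Z_4) : exists2 e, inscribed e & direction e = w ^+ i * u.
  by apply: inscribed_exists; rewrite normrM normrX w1 u1 expr1n mulr1.
have [delta ins dirE] := fin_all_exists2 vertex.
have dir0 : direction (delta 0) = u by rewrite dirE mul1r.
by exists delta; [split=> // i; rewrite dir0 dirE | rewrite /phase dir0].
Qed.

Lemma steiner4_inscribed delta i :
  steiner4_chain gam Gam delta -> inscribed (delta i).
Proof. by case. Qed.

Lemma steiner4_memP delta e : steiner4_chain gam Gam delta -> inscribed e ->
  (exists i, delta i = e) <-> direction e ^+ 4 = phase delta.
Proof.
move=> /steiner4_turning[w [w2 ins dirE]] ie; have w_prim := sqrN1_prim_root w2.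
have u_neq0 := norm1_neq0 (direction_norm1 (ins 0)).
split=> [[i <-]|phaseE].
  by rewrite dirE exprMn exprAC (prim_expr_order w_prim) expr1n mul1r.
have [|i iE] := prim_rootP w_prim (x := direction e / direction (delta 0)).
  by rewrite expr_div_n phaseE divff ?expf_neq0.
by exists i; apply: direction_inj => //; rewrite dirE -iE divfK.
Qed.

Lemma steiner4_phase delta i : steiner4_chain gam Gam delta ->
  direction (delta i) ^+ 4 = phase delta.
Proof.
move=> chain; apply/steiner4_memP => //; last by exists i.
exact: steiner4_inscribed.
Qed.

Lemma phase_norm1 delta : steiner4_chain gam Gam delta -> `|phase delta| = 1.
Proof.
by move=> /steiner4_inscribed ins; rewrite normrX direction_norm1 // expr1n.
Qed.

Lemma same_circlesP delta eps :
  steiner4_chain gam Gam delta -> steiner4_chain gam Gam eps ->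
  same_circles delta eps <-> phase delta = phase eps.
Proof.
move=> chain chain'; split=> [same|phaseE e].
  have [i epsE] := (same (delta 0)).1 (ex_intro _ 0 erefl).
  by rewrite -(steiner4_phase i chain') epsE.
split=> -[i <-]; apply/steiner4_memP; rewrite ?steiner4_phase //;
  exact: steiner4_inscribed.
Qed.

Lemma same_cyclic_sequenceP w w' delta eps :
  turning w delta -> turning w' eps ->
  same_cyclic_sequence delta eps <-> w = w' /\ phase delta = phase eps.
Proof.
move=> T T'; have [_ ins _] := T; have [_ ins' dirE'] := T'.
split=> [[k epsE]|[wE phaseE]].
  split; last first.
    apply/esym/(steiner4_memP (turning_steiner4 T)) => //.
    by exists k; rewrite epsE add0r.
  have := turningD 1 k T; rewrite -epsE -[k]add0r -epsE dirE' !expr1.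
  by move/mulIf => -> //; apply/norm1_neq0/direction_norm1.
have [k kE] : exists k, delta k = eps 0.
  exact/(steiner4_memP (turning_steiner4 T)).
exists k => i; apply: direction_inj => //.
by rewrite dirE' -kE -wE -turningD.
Qed.

Lemma on_axis_phase delta i : steiner4_chain gam Gam delta ->
  on_line (center gam) (center Gam) (center (delta i)) -> phase delta = 1.
Proof.
move=> chain /on_axis_direction dir_sqr; rewrite -(steiner4_phase i chain).
by rewrite (exprM _ 2 2) dir_sqr ?expr1n //; apply: steiner4_inscribed.
Qed.

Lemma axial_chainP delta : axial_chain gam Gam delta <->
  steiner4_chain gam Gam delta /\ phase delta = 1.
Proof.
split=> [[chain [i [_ [_ on_axis _]]]]|[chain phase1]].
  by split=> //; apply: on_axis_phase on_axis.
have on_axis u : `|u| = 1 -> u ^+ 2 = 1 -> exists2 i, direction (delta i) = u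
    & on_line (center gam) (center Gam) (center (delta i)).
  move=> u1 u_sqr; have [e ins dirE] := inscribed_exists u1.
  have [|i eE] := (steiner4_memP chain ins).2.
    by rewrite dirE phase1 (exprM _ 2 2) u_sqr expr1n.
  by exists i; rewrite eE //; apply/on_axis_direction; rewrite ?dirE.
have [i dir_i on_i] := on_axis 1 (normr1 _) (expr1n _ 2).
have [|j dir_j on_j] := on_axis (-1) (normrN1 _); first by rewrite sqrrN expr1n.
split=> //; exists i, j; split=> //; apply/eqP => ij.
by move/eqP: dir_j; rewrite -ij dir_i eq_sym eqNr oner_eq0.
Qed.

Lemma lateral_chainP delta : lateral_chain gam Gam delta <->
  steiner4_chain gam Gam delta /\ phase delta = -1.
Proof.
split=> [[chain sym off]|[chain phaseN1]].
  split=> //; have [j reflectE] := sym 0.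
  have phaseJ : (phase delta)^* = phase delta.
    rewrite -{2}(steiner4_phase j chain) reflectE.
    by rewrite direction_reflect -rmorphXn.
  have /eqP := phaseJ; rewrite -CrealE -norm1_sqr_eq1 ?phase_norm1 // sqrf_eq1.
  case/orP => /eqP // phase1.
  have [_ [i [_ [_ on_i _]]]] := (axial_chainP delta).2 (conj chain phase1).
  by case: (off i).
split=> // i.
  have ins := steiner4_inscribed i chain.
  apply/(steiner4_memP chain); first exact: inscribed_reflect.
  by rewrite direction_reflect -rmorphXn /= steiner4_phase // phaseN1 rmorphN1.
move=> /(on_axis_phase chain); rewrite phaseN1 => /eqP.
by rewrite eqNr oner_eq0.
Qed.

Lemma axial_exists : exists delta, axial_chain gam Gam delta.
Proof.
have [delta T phaseE] := turning_exists (sqrCi _) (normr1 K[i]).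
exists delta; apply/axial_chainP; rewrite phaseE expr1n.
by split; first exact: turning_steiner4 T.
Qed.

(** * The sum of the radii *)

Definition radii_sum_at (t : K) : K := 32%:R * R * r * (R - r) * (R + r) ^+ 2
  / (2%:R * (R + r) ^+ 4 - d ^+ 4 * (1 + t)).

Lemma radii_sumE delta : steiner4_chain gam Gam delta ->
  radii_sum delta = radii_sum_at (Re (phase delta)).
Proof.
move=> /steiner4_turning[w [w2 ins dirE]]; rewrite /radii_sum /radii_sum_at.
under eq_bigr do rewrite radiusE dirE.
have d_lt : `|d| < R - r.
  by rewrite gtr0_norm //; have := center_distance_lt; have := r_gt0; lra.
rewrite -mulr_sumr (quarter_turns_sum w2 (direction_norm1 (ins 0)) d_lt).
have -> : 2%:R * (R - r) ^+ 2 - d ^+ 2 = (R + r) ^+ 2 by rewrite d_sqr; ring.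
by rewrite mulrA; congr (_ / _); ring.
Qed.

Lemma radii_sum_at_mono t t' :
  t <= t' <= 1 -> radii_sum_at t <= radii_sum_at t'.
Proof.
move=> /andP[tt' t'1]; rewrite /radii_sum_at.
have [r0 R0] := (r_gt0, R_gt0).
have diff_gt0 : 0 < R - r by rewrite subr_gt0.
have sum_gt0 : 0 < R + r by rewrite addr_gt0.
have num_gt0 : 0 < 32%:R * R * r * (R - r) * (R + r) ^+ 2.
  by rewrite !mulr_gt0 ?exprn_gt0 ?ltr0n.
have d4_lt : d ^+ 4 < (R + r) ^+ 4.
  rewrite ltr_pXn2r ?nnegrE ?ltW //.
  by have := center_distance_lt; lra.
have d4_gt0 : 0 < d ^+ 4 by rewrite exprn_gt0.
by rewrite ler_pM2l // lef_pV2 ?posrE; nra.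
Qed.

Lemma radii_sum_bounds delta : steiner4_chain gam Gam delta ->
  radii_sum_at (-1) <= radii_sum delta <= radii_sum_at 1.
Proof.
move=> chain; rewrite radii_sumE //.
have /andP[ge_N1 le_1] := Re_norm1_bounds (phase_norm1 chain).
by rewrite !radii_sum_at_mono ?ge_N1 ?le_1 ?lexx.
Qed.

Lemma axial_radii_sum delta :
  axial_chain gam Gam delta -> radii_sum delta = radii_sum_at 1.
Proof. by move=> /axial_chainP[chain phase1]; rewrite radii_sumE ?phase1. Qed.

Lemma lateral_radii_sum delta :
  lateral_chain gam Gam delta -> radii_sum delta = radii_sum_at (-1).
Proof.
by move=> /lateral_chainP[chain phaseN1]; rewrite radii_sumE ?phaseN1.
Qed.

Lemma radii_sum_at1 : radii_sum_at 1 = (R + r) ^+ 2 / (R - r).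
Proof.
have den_factor : 2%:R * (R + r) ^+ 4 - d ^+ 4 * (1 + 1)
    = 32%:R * R * r * (R - r) ^+ 2.
  by rewrite [d ^+ 4](exprM _ 2 2) d_sqr; ring.
by rewrite /radii_sum_at den_factor; field; rewrite !gt_eqF ?subr_gt0.
Qed.

Lemma radii_sum_atN1 :
  radii_sum_at (-1) = 16%:R * R * r * (R - r) / (R + r) ^+ 2.
Proof.
have sum_neq0 : R + r != 0 by rewrite gt_eqF // addr_gt0.
by rewrite /radii_sum_at subrr mulr0 subr0; field.
Qed.

Lemma axial_same_circles delta eps :
  axial_chain gam Gam delta -> axial_chain gam Gam eps ->
  same_circles delta eps.
Proof.
move=> /axial_chainP[chain phase1] /axial_chainP[chain' phase1'].
by apply/same_circlesP; rewrite ?phase1.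
Qed.

Lemma lateral_exists2 : exists delta eps,
  [/\ lateral_chain gam Gam delta, lateral_chain gam Gam eps,
      ~ same_cyclic_sequence delta eps
    & forall zeta, lateral_chain gam Gam zeta ->
        same_cyclic_sequence delta zeta \/ same_cyclic_sequence eps zeta].
Proof.
have u4 : (sqrtC 'i : K[i]) ^+ 4 = -1 by rewrite (exprM _ 2 2) sqrtCK sqrCi.
have u1 : `|sqrtC 'i : K[i]| = 1.
  by apply: (norm1_of_exp (n := 4)); rewrite ?u4 ?normrN1.
have [delta T phaseE] := turning_exists (sqrCi _) u1.
have iN : (- 'i : K[i]) ^+ 2 = -1 by rewrite sqrrN sqrCi.
have [eps T' phaseE'] := turning_exists iN u1.
exists delta, eps; split.
- apply/lateral_chainP; rewrite phaseE u4.
  by split; first exact: turning_steiner4 T.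
- apply/lateral_chainP; rewrite phaseE' u4.
  by split; first exact: turning_steiner4 T'.
- move=> /(same_cyclic_sequenceP T T')[iE _].
  by have /negP[] := neq0Ci K[i]; rewrite -eqNr -iE.
- move=> zeta /lateral_chainP[/steiner4_turning[w Tw] phaseN1].
  have [w2 _ _] := Tw; move/eqP: w2; rewrite -(sqrCi K[i]) eqf_sqr.
  case/orP => /eqP wE.
    by left; apply/(same_cyclic_sequenceP T Tw); rewrite wE phaseE u4.
  by right; apply/(same_cyclic_sequenceP T' Tw); rewrite wE phaseE' u4.
Qed.

End Annulus.

Theorem theorem3 (K : rcfType) (R r d : K) (Gam gam : circle K)
  (hr : 0 < r) (hrR : r < R) (hd : 0 < d)
  (hdRr : d ^+ 2 = R ^+ 2 - 6%:R * R * r + r ^+ 2)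
  (hGam : radius Gam = R) (hgam : radius gam = r)
  (hcent : dist (center gam) (center Gam) = d) :
  let a := r^-1 in
  let A := - R^-1 in
  let Lmax := - ((A ^+ 2 - 2%:R * A * a + a ^+ 2) / (A * a * (a + A))) in
  let Lmin := 16%:R * (A + a) / (A ^+ 2 - 2%:R * A * a + a ^+ 2) in
  (* the axial chain exists and is unique up to the numbering of its circles *)
  ((exists delta, axial_chain gam Gam delta) /\
   (forall delta eps, axial_chain gam Gam delta -> axial_chain gam Gam eps ->
      same_circles delta eps)) /\
  (* there are exactly two lateral chains, as cyclic sequences of circles *)
  (exists delta eps,
     [/\ lateral_chain gam Gam delta, lateral_chain gam Gam eps,
         ~ same_cyclic_sequence delta eps
       & forall zeta, lateral_chain gam Gam zeta ->
           same_cyclic_sequence delta zeta \/ same_cyclic_sequence eps zeta]) /\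
  (* the maximum *)
  ((forall delta, steiner4_chain gam Gam delta -> radii_sum delta <= Lmax) /\
   (forall delta, axial_chain gam Gam delta -> radii_sum delta = Lmax)) /\
  (* the minimum *)
  ((forall delta, steiner4_chain gam Gam delta -> Lmin <= radii_sum delta) /\
   (forall delta, lateral_chain gam Gam delta -> radii_sum delta = Lmin)).
Proof.
move=> a A Lmax Lmin; subst R r d.
have [r0 R0] := (gt_eqF hr, gt_eqF (radius_gt0 Gam)).
have diff0 : radius Gam - radius gam != 0 by rewrite subr_eq0 gt_eqF.
have sum0 : radius Gam + radius gam != 0.
  by rewrite gt_eqF ?addr_gt0 ?radius_gt0.
have curvature_diff_sqr : A ^+ 2 - 2%:R * A * a + a ^+ 2
    = ((radius Gam + radius gam) / (radius Gam * radius gam)) ^+ 2.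
  by rewrite /A /a; field; rewrite r0 R0.
have -> : Lmax = radii_sum_at gam Gam 1.
  rewrite radii_sum_at1 // /Lmax curvature_diff_sqr /A /a.
  by field; rewrite r0 R0 diff0.
have -> : Lmin = radii_sum_at gam Gam (-1).
  rewrite radii_sum_atN1 // /Lmin curvature_diff_sqr /A /a.
  by field; rewrite r0 R0 sum0.
split; [split|split; [|split; split]].
- exact: axial_exists.
- exact: axial_same_circles.
- exact: lateral_exists2.
- by move=> delta chain; have /andP[] := radii_sum_bounds hrR hd hdRr chain.
- exact: axial_radii_sum.
- by move=> delta chain; have /andP[] := radii_sum_bounds hrR hd hdRr chain.
- exact: lateral_radii_sum.
Qed.
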